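(* Let $p,q\ge 1$ be integers with $p+q=n$. Let $X_1,\ldots,X_n$ be independent random variables such that $X_i\sim W(\alpha,\lambda_1)$ for $i=1,\ldots,p$ and $X_j\sim W(\alpha,\lambda_2)$ for $j=p+1,\ldots,n$, with $\lambda_1,\lambda_2>0$. Let $Y_1,\ldots,Y_n$ be another set of independent random variables such that $Y_i\sim W(\alpha,\theta_1)$ for $i=1,\ldots,p$ and $Y_j\sim W(\alpha,\theta_2)$ for $j=p+1,\ldots,n$, with $\theta_1,\theta_2>0$. Let $X_{n:n}^{\lambda}=\max(X_1,\ldots,X_n)$ and $X_{n:n}^{\theta}=\max(Y_1,\ldots,Y_n)$. Then, for $0<\alpha\le 1$, $$(\underbrace{\lambda_1,\ldots,\lambda_1}_{p},\underbrace{\lambda_2,\ldots,\lambda_2}_{q})\preceq^{m}(\underbrace{\theta_1,\ldots,\theta_1}_{p},\underbrace{\theta_2,\ldots,\theta_2}_{q})\ \Rightarrow\ X_{n:n}^{\lambda}\le_{lr}X_{n:n}^{\theta}.$$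
   Context: Weibull distribution: $X\sim W(\alpha,\lambda)$ (shape $\alpha>0$, parameter $\lambda>0$) means $X$ has density $f(t)=\alpha\lambda(\lambda t)^{\alpha-1}e^{-(\lambda t)^{\alpha}}$ for $t>0$, i.e. distribution function $1-e^{-(\lambda t)^{\alpha}}$ for $t>0$. ''Increasing'' means non-decreasing. Majorization: for $x,y\in\mathbb{R}^n$ with increasing arrangements $x_{(1)}\le\cdots\le x_{(n)}$ and $y_{(1)}\le\cdots\le y_{(n)}$, $x\preceq^{m}y$ means $\sum_{i=1}^{j}x_{(i)}\ge\sum_{i=1}^{j}y_{(i)}$ for $j=1,\ldots,n-1$ and $\sum_{i=1}^{n}x_{(i)}=\sum_{i=1}^{n}y_{(i)}$. Likelihood ratio order: for random variables $X,Y$ with densities $f,g$, $X\le_{lr}Y$ means that $g(t)/f(t)$ is increasing in $t$ over all $t$ for which the ratio is well defined (here, $t>0$). *)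

(* Defs.v *)
From HB Require Import structures.
From mathcomp Require Import all_boot all_order all_algebra.
From mathcomp Require Import all_classical all_reals all_analysis measurable_realfun.

Set Implicit Arguments.
Unset Strict Implicit.
Unset Printing Implicit Defensive.

Import Order.TTheory GRing.Theory Num.Theory.
Import numFieldNormedType.Exports.

Local Open Scope classical_set_scope.
Local Open Scope ring_scope.

(* [order_stat x i] is the (i+1)-th smallest coordinate x_(i+1) of x. *)
Definition order_stat (R : realType) (n : nat) (x : 'I_n -> R) (i : nat) : R :=
  (sort <=%R (codom x))`_i.

Definition majorized (R : realType) (n : nat) (x y : 'I_n -> R) : Prop :=
  (forall j : nat, (1 <= j <= n.-1)%N ->
    \sum_(0 <= i < j) order_stat y i <= \sum_(0 <= i < j) order_stat x i) /\
  \sum_(0 <= i < n) order_stat x i = \sum_(0 <= i < n) order_stat y i.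

Notation "x ⪯m y" := (majorized x y) (at level 70, no associativity).

Definition has_density (d : measure_display) (T : measurableType d)
    (R : realType) (P : probability T R) (X : {RV P >-> R}) (f : R -> R) :
    Prop :=
  [/\ measurable_fun setT f,
      forall t, 0 <= f t &
      forall A : set R, measurable A ->
        distribution P X A = (\int[lebesgue_measure]_(t in A) (f t)%:E)%E].

Definition weibull_pdf (R : realType) (alpha lambda t : R) : R :=
  if 0 < t then
    alpha * lambda * (lambda * t) `^ (alpha - 1) *
      expR (- (lambda * t) `^ alpha)
  else 0.

Definition weibull_distributed (d : measure_display) (T : measurableType d)
    (R : realType) (P : probability T R) (X : {RV P >-> R})
    (alpha lambda : R) : Prop :=
  has_density X (weibull_pdf alpha lambda).

Definition independent_RVs (d : measure_display) (T : measurableType d)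
    (R : realType) (P : probability T R) (n : nat)
    (X : 'I_n -> {RV P >-> R}) : Prop :=
  forall (J : {set 'I_n}) (A : 'I_n -> set R),
    (forall i, measurable (A i)) ->
    P (\bigcap_(i in [set` J]) (X i @^-1` A i)) =
    (\prod_(i in J) P (X i @^-1` A i))%E.

Definition max_RV (d : measure_display) (T : measurableType d)
    (R : realType) (P : probability T R) (n : nat)
    (X : 'I_n.+1 -> {RV P >-> R}) (w : T) : R :=
  \big[Num.max/X ord0 w]_(i < n.+1) X i w.

Lemma measurable_max_RV (d : measure_display) (T : measurableType d)
    (R : realType) (P : probability T R) (n : nat)
    (X : 'I_n.+1 -> {RV P >-> R}) : measurable_fun setT (max_RV X).
Proof.
rewrite /max_RV; under eq_fun do rewrite -big_enum /=.
elim: (enum _) => [|i s IHs].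
  by under eq_fun do rewrite big_nil; exact: measurable_funPT.
under eq_fun do rewrite big_cons.
by apply: measurable_maxr => //; exact: measurable_funPT.
Qed.

HB.instance Definition _ (d : measure_display) (T : measurableType d)
    (R : realType) (P : probability T R) (n : nat)
    (X : 'I_n.+1 -> {RV P >-> R}) :=
  isMeasurableFun.Build _ _ _ _ (max_RV X) (measurable_max_RV X).

(* Densities are only determined up to null sets, so the order asks for some
   densities f of X and g of Y with g / f increasing.  The ratio is well defined
   when f t and g t are not both 0; it is taken in the extended reals, where
   0^-1 = +oo, so that c / 0 = +oo for c > 0. *)
Definition lr_le (R : realType)
    (d : measure_display) (T : measurableType d) (P : probability T R)
    (d' : measure_display) (T' : measurableType d') (Q : probability T' R)
    (X : {RV P >-> R}) (Y : {RV Q >-> R}) : Prop :=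
  exists f g : R -> R,
    [/\ has_density X f, has_density Y g &
        forall s t : R, s <= t ->
          f s != 0 \/ g s != 0 -> f t != 0 \/ g t != 0 ->
          ((g s)%:E / (f s)%:E <= (g t)%:E / (f t)%:E)%E].

(* The vector (a, ..., a, b, ..., b) of R^n whose first p coordinates are a. *)
Definition two_block (R : realType) (n p : nat) (a b : R) (i : 'I_n) : R :=
  if (i < p)%N then a else b.
Arguments two_block {R} n p a b i.

(* Main.v *)
(* Put x_i(t) = (lambda_i t)^alpha and h(x) = x / (e^x - 1).  The maximum has
   distribution function F = prod_i (1 - e^(-x_i)) and density F S alpha / t with
   S = sum_i h(x_i), so the ratio of the two densities is
   (F_theta / F_lambda) (S_theta / S_lambda).  The first factor increases if
   S_lambda <= S_theta.  Since x h'(x) = h(x) (1 - w(x)) with w(x) = x + h(x), the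
   second increases if sum_theta h (w - a) <= 0 for the h-weighted mean a of w
   over the lambda-sample, where sum_lambda h (w - a) = 0.  Both inequalities have
   the form sum_i f(theta_i) <= sum_i f(lambda_i) for a function f which is concave
   as long as it increases (x being a concave function of lambda); since lambda
   takes only two values c <= b and no theta_i lies strictly between them, f is
   dominated at the theta_i by its chord through c and b, and the sum of an affine
   function only depends on the sum of the arguments. *)
From HB Require Import structures.
Require Import Defs.
From mathcomp Require Import all_boot all_order all_algebra.
From mathcomp Require Import all_classical all_reals all_analysis measurable_realfun.
From mathcomp Require Import ring lra.

Set Implicit Arguments.
Unset Strict Implicit.
Unset Printing Implicit Defensive.

Import Order.TTheory GRing.Theory Num.Theory.
Import numFieldNormedType.Exports.

Local Open Scope classical_set_scope.
Local Open Scope ring_scope.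

(** * Differentiation rules on the line, and monotonicity from the sign of a derivative *)

Section derivatives.
Context {R : realType}.
Implicit Types (f g df : R -> R) (x a b : R).

Lemma is_derive1D f g x a b : is_derive x 1 f a -> is_derive x 1 g b ->
  is_derive x 1 (fun y => f y + g y) (a + b).
Proof. by move=> fa gb; apply: is_deriveD. Qed.

Lemma is_derive1N f x a : is_derive x 1 f a ->
  is_derive x 1 (fun y => - f y) (- a).
Proof. by move=> fa; apply: is_deriveN. Qed.

Lemma is_derive1M f g x a b : is_derive x 1 f a -> is_derive x 1 g b ->
  is_derive x 1 (fun y => f y * g y) (a * g x + f x * b).
Proof.
move=> fa gb; have := is_deriveM fa gb.
by rewrite /GRing.scale /= addrC [g x * a]mulrC.
Qed.

Lemma is_derive1V f x a : f x != 0 -> is_derive x 1 f a ->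
  is_derive x 1 (fun y => (f y)^-1) (- a / f x ^+ 2).
Proof.
move=> fx0 fa; have := is_deriveV fx0 fa.
by rewrite /GRing.scale /= mulNr mulrC -mulNr.
Qed.

Lemma is_derive1_sum n (F : 'I_n -> R -> R) x (D : 'I_n -> R) :
  (forall i, is_derive x 1 (F i) (D i)) ->
  is_derive x 1 (fun y => \sum_i F i y) (\sum_i D i).
Proof.
move=> FD; rewrite (_ : (fun y => _) = \sum_i F i); first exact: is_derive_sum.
by apply/funext => y; rewrite fct_sumE.
Qed.

(** Here [D i] is a logarithmic derivative of [F i]; these add up under products. *)
Lemma is_derive1_prod n (F : 'I_n -> R -> R) x (D : 'I_n -> R) :
  (forall i, is_derive x 1 (F i) (F i x * D i)) ->
  is_derive x 1 (fun y => \prod_i F i y) (\prod_i F i x * \sum_i D i).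
Proof.
move=> FD; elim: n F D FD => [|n IHn] F D FD.
  under eq_fun do rewrite big_ord0.
  by rewrite !big_ord0 mulr0; exact: is_derive_cst.
under eq_fun do rewrite big_ord_recl.
rewrite !big_ord_recl.
have := is_derive1M (FD ord0) (IHn (fun i => F (lift ord0 i)) _
  (fun i => FD (lift ord0 i))).
by congr is_derive; ring.
Qed.

Lemma is_derive1_continuous f x a : is_derive x 1 f a -> {for x, continuous f}.
Proof.
by move=> [df _]; apply/differentiable_continuous; rewrite -derivable1_diffP.
Qed.

Lemma mean_value f df a b : a <= b ->
    (forall x, a <= x <= b -> is_derive x 1 f (df x)) ->
  exists c, [/\ a <= c, c <= b & f b - f a = df c * (b - a)].
Proof.
move=> ab fdf; have [] := @MVT_segment _ f df a b ab.
- by move=> x; rewrite in_itv/= => /andP[ax xb]; apply: fdf; rewrite !ltW.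
- apply: derivable_within_continuous => x.
  by rewrite in_itv/= => axb; have [] := fdf x axb.
- by move=> c; rewrite in_itv/= => /andP[ac cb] E; exists c.
Qed.

Lemma ge0_derive_le f df a b : a <= b ->
  (forall x, a <= x <= b -> is_derive x 1 f (df x)) ->
  (forall x, a <= x <= b -> 0 <= df x) -> f a <= f b.
Proof.
move=> ab fdf df0; have [c [ac cb E]] := mean_value ab fdf.
by rewrite -subr_ge0 E mulr_ge0 ?subr_ge0// df0// ac.
Qed.

Lemma le0_derive_ge f df a b : a <= b ->
  (forall x, a <= x <= b -> is_derive x 1 f (df x)) ->
  (forall x, a <= x <= b -> df x <= 0) -> f b <= f a.
Proof.
move=> ab fdf df0; have [c [ac cb E]] := mean_value ab fdf.
by rewrite -subr_le0 E mulr_le0_ge0 ?subr_ge0// df0// ac.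
Qed.

(** The last hypothesis is the sign of the numerator in the quotient rule. *)
Lemma ratio_homo f g df dg : (forall x, 0 < x -> is_derive x 1 f (df x)) ->
  (forall x, 0 < x -> is_derive x 1 g (dg x)) ->
  (forall x, 0 < x -> 0 < f x) ->
  (forall x, 0 < x -> g x * df x <= dg x * f x) ->
  forall a b, 0 < a -> a <= b -> g a / f a <= g b / f b.
Proof.
move=> fdf gdg f0 dfg a b a0 ab.
have pos x : a <= x <= b -> 0 < x by move=> /andP[+ _]; exact: lt_le_trans.
apply: (ge0_derive_le (f := fun x => g x / f x) ab) => x /pos x0.
  apply: is_derive1M; first exact: gdg.
  by apply: is_derive1V; [rewrite gt_eqF// f0 | exact: fdf].
have fx0 := f0 _ x0.
rewrite (_ : _ + _ = (dg x * f x - g x * df x) / f x ^+ 2); last first.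
  by field; rewrite gt_eqF.
by rewrite divr_ge0 ?sqr_ge0// subr_ge0 dfg.
Qed.

End derivatives.

(** * Elementary inequalities for the exponential *)

Section exponential_inequalities.
Context {R : realType}.
Implicit Types x : R.

Lemma expR_sub1_gt0 x : 0 < x -> 0 < expR x - 1.
Proof. by move=> x0; rewrite subr_gt0 expR_gt1. Qed.

(** The strict inequality 1 - x < e^(-x), multiplied by e^x. *)
Lemma expR_mul_sub1_gt0 x : 0 < x -> 0 < (x - 1) * expR x + 1.
Proof.
move=> x0; have /expR_gt1Dx : - x != 0 by rewrite oppr_eq0 gt_eqF.
rewrite expRN -(ltr_pM2r (expR_gt0 x)) mulVf ?gt_eqF ?expR_gt0//.
by lra.
Qed.

(** A form of x <= sinh x: the difference of the sides vanishes at 0 and has derivative 2 e^x (e^x -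
    1 - x) >= 0. *)
Lemma mul2_expR_le x : 0 < x -> 2 * x * expR x <= expR x * expR x - 1.
Proof.
move=> /ltW x0; rewrite -subr_ge0.
have := @ge0_derive_le R (fun z => expR z * expR z - 1 - 2 * z * expR z)
  (fun z => 2 * expR z * (expR z - 1 - z)) 0 x x0.
rewrite expR0 mulr0 mul0r mulr1 !subr0 subrr; apply => z /andP[z0 _].
  apply: is_derive_eq; rewrite /GRing.scale/=; by ring.
rewrite mulr_ge0 ?mulr_ge0 ?expR_ge0// -addrA -opprD subr_ge0.
exact: expR_ge1Dx.
Qed.

Lemma mul_expR_half_le x : 0 < x -> x * expR (x / 2) <= expR x - 1.
Proof.
move=> x0; have /mul2_expR_le : 0 < x / 2 by rewrite divr_gt0.
by rewrite -expRD -splitr [2 * _]mulrC divfK.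
Qed.

(** The square of the previous bound, x <= 2 sinh (x / 2); it makes [bose_slope] increase. *)
Lemma sqr_mul_expR_le x : 0 < x -> x ^+ 2 * expR x <= (expR x - 1) ^+ 2.
Proof.
move=> x0; have := mul_expR_half_le x0.
rewrite -(@ler_pXn2r _ 2)// ?nnegrE ?mulr_ge0 ?expR_ge0 ?(ltW x0)//; last first.
  exact/ltW/expR_sub1_gt0.
by rewrite exprMn [expR _ ^+ 2]expr2 -expRD -splitr.
Qed.

(** A form of tanh (x / 2) <= x / 2: the difference of the sides vanishes at 0 and has derivative (x
    - 1) e^x + 1. *)
Lemma mul2_expR_sub1_le x : 0 < x -> 2 * (expR x - 1) <= x * (expR x + 1).
Proof.
move=> /ltW x0; rewrite -subr_ge0.
have := @ge0_derive_le R (fun z => z * (expR z + 1) - 2 * (expR z - 1))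
  (fun z => (z - 1) * expR z + 1) 0 x x0.
rewrite expR0 mul0r subrr mulr0 subrr; apply => z /andP[z0 _].
  apply: is_derive_eq; rewrite /GRing.scale/=; by ring.
(* The strict bound covers z > 0; at z = 0 the derivative is 0. *)
have [z1|/expR_mul_sub1_gt0/ltW//] := leP z 0.
by rewrite (le_anti (introT andP (conj z1 z0))) expR0 sub0r mulN1r addNr.
Qed.

End exponential_inequalities.

(** * The function x / (e^x - 1): monotonicity, convexity and derived quantities *)

Section bose.
Context {R : realType}.
Implicit Types x a : R.

(* The reversed hazard rate of the exponential law is [bose x / x]. *)
Definition bose x := x / (expR x - 1).

(* [(bose x + x - 1) / x], so that [bose^`() = - bose * bose_slope]. *)
Definition bose_slope x := 1 + (expR x - 1)^-1 - x^-1.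

Lemma bose_gt0 x : 0 < x -> 0 < bose x.
Proof. by move=> x0; rewrite divr_gt0// expR_sub1_gt0. Qed.

Lemma bose_slope_gt0 x : 0 < x -> 0 < bose_slope x.
Proof.
move=> x0; have E0 := expR_sub1_gt0 x0.
rewrite (_ : bose_slope x = ((x - 1) * expR x + 1) / (x * (expR x - 1))).
  by rewrite divr_gt0 ?mulr_gt0// expR_mul_sub1_gt0.
by rewrite /bose_slope; field; rewrite !gt_eqF.
Qed.

Lemma is_derive_expR_sub1 x : is_derive x 1 (fun y => expR y - 1) (expR x).
Proof. by apply: is_derive_eq; rewrite oppr0 addr0. Qed.

Lemma is_derive_bose x : 0 < x ->
  is_derive x 1 bose (- (bose x * bose_slope x)).
Proof.
move=> x0; have E0 := expR_sub1_gt0 x0.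
have := is_derive1M (is_derive_id x 1)
  (is_derive1V (f := fun y => expR y - 1) (lt0r_neq0 E0) (is_derive_expR_sub1 x)).
by rewrite /bose /bose_slope; congr is_derive; field; rewrite !gt_eqF.
Qed.

Lemma is_derive_bose_slope x : 0 < x ->
  is_derive x 1 bose_slope (x ^- 2 - expR x / (expR x - 1) ^+ 2).
Proof.
move=> x0; have E0 := expR_sub1_gt0 x0.
have := is_derive1D (is_derive1D (is_derive_cst (1 : R) x 1)
  (is_derive1V (f := fun y => expR y - 1) (lt0r_neq0 E0) (is_derive_expR_sub1 x)))
  (is_derive1N (is_derive1V (f := id) (lt0r_neq0 x0) (is_derive_id x 1))).
by congr is_derive; field; rewrite !gt_eqF.
Qed.

Lemma bose_slope_homo x y : 0 < x -> x <= y -> bose_slope x <= bose_slope y.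
Proof.
move=> x0 xy; apply: (ge0_derive_le xy) => z /andP[/(lt_le_trans x0) z0 _].
  exact: is_derive_bose_slope.
have E0 := expR_sub1_gt0 z0.
rewrite subr_ge0 ler_pdivrMr ?exprn_gt0// mulrC ler_pdivlMr ?exprn_gt0//.
by rewrite mulrC sqr_mul_expR_le.
Qed.

(** Clearing denominators gives [mul2_expR_le]; the bound 1/2 is the limit at 0. *)
Lemma bose_mul_slope_le x : 0 < x -> bose x * bose_slope x <= 2^-1.
Proof.
move=> x0; have E0 := expR_sub1_gt0 x0.
rewrite (_ : bose x * _ = ((x - 1) * expR x + 1) / (expR x - 1) ^+ 2).
  rewrite ler_pdivrMr ?exprn_gt0//; have := mul2_expR_le x0; lra.
by rewrite /bose /bose_slope; field; rewrite !gt_eqF.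
Qed.

(** Convexity of [bose], whose derivative is minus this product. *)
Lemma bose_mul_slope_nhomo x y : 0 < x -> x <= y ->
  bose y * bose_slope y <= bose x * bose_slope x.
Proof.
move=> x0 xy.
apply: (le0_derive_ge (f := fun z => bose z * bose_slope z) xy) =>
    z /andP[/(lt_le_trans x0) z0 _].
  exact: is_derive1M (is_derive_bose z0) (is_derive_bose_slope z0).
have E0 := expR_sub1_gt0 z0.
rewrite (_ : _ + _ = expR z * (2 * (expR z - 1) - z * (expR z + 1)) /
    (expR z - 1) ^+ 3); last first.
  by rewrite /bose /bose_slope; field; rewrite !gt_eqF.
rewrite ler_pdivrMr ?exprn_gt0// mul0r mulr_ge0_le0 ?expR_ge0// subr_le0.
exact: mul2_expR_sub1_le.
Qed.

Lemma bose_nhomo x y : 0 < x -> x <= y -> bose y <= bose x.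
Proof.
move=> x0 xy; apply: (le0_derive_ge xy) => z /andP[/(lt_le_trans x0) z0 _].
  exact: is_derive_bose.
by rewrite oppr_le0 mulr_ge0 ?ltW ?bose_gt0 ?bose_slope_gt0.
Qed.

Lemma id_add_bose_homo x y : 0 < x -> x <= y -> x + bose x <= y + bose y.
Proof.
move=> x0 xy; apply: (ge0_derive_le (f := fun z => z + bose z) xy) =>
    z /andP[/(lt_le_trans x0) z0 _].
  exact: is_derive1D (is_derive_id z 1) (is_derive_bose z0).
by have := bose_mul_slope_le z0; lra.
Qed.

(* [bose * (id + bose - a)] increases at [x] iff [bose_level x <= a]. *)
Definition bose_level x := x + 2 * bose x - (bose_slope x)^-1.

(** The derivative of [x + 2 * bose x] is nonnegative by [bose_mul_slope_le], and the subtracted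
    inverse decreases because [bose_slope] increases. *)
Lemma bose_level_homo x y : 0 < x -> x <= y -> bose_level x <= bose_level y.
Proof.
move=> x0 xy; rewrite lerB//; last first.
  have y0 := lt_le_trans x0 xy.
  by rewrite lef_pV2 ?posrE ?bose_slope_gt0// bose_slope_homo.
apply: (ge0_derive_le (f := fun z => z + 2 * bose z)
    (df := fun z => 1 - 2 * (bose z * bose_slope z)) xy) =>
    z /andP[/(lt_le_trans x0) z0 _].
  have := is_derive1D (is_derive_id z 1)
    (is_derive1M (is_derive_cst (2 : R) z 1) (is_derive_bose z0)).
  by congr is_derive; rewrite mul0r add0r mulrN.
by have := bose_mul_slope_le z0; lra.
Qed.

(** Hence [bose * (id + bose - a)] increases wherever [id + bose] is at most [a]. *)
Lemma bose_level_le x : 0 < x -> bose_level x <= x + bose x.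
Proof.
move=> x0; have v0 := bose_slope_gt0 x0.
rewrite /bose_level lerBlDr -addrA lerD2l mulr_natl mulr2n lerD2l.
rewrite -(ler_pM2r v0) mulVf ?gt_eqF//.
by have := bose_mul_slope_le x0; lra.
Qed.

Lemma is_derive_bose_weighted a x : 0 < x ->
  is_derive x 1 (fun y => bose y * (y + bose y - a))
    (bose x * bose_slope x * (a - bose_level x)).
Proof.
move=> x0; have v0 := bose_slope_gt0 x0.
have := is_derive1M (is_derive_bose x0) (is_derive1D (is_derive1D
  (is_derive_id x 1) (is_derive_bose x0)) (is_derive_cst (- a) x 1)).
by rewrite /bose_level /cst/=; congr is_derive; field; rewrite gt_eqF.
Qed.

End bose.

(** * Comparison of sums when one sample takes only two values *)

Section concave_then_decreasing.
Context {R : realType}.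

(* The condition on [D] says that [f] is concave as long as it increases.  Then
   the chord of [f] through [c] and [b] lies above [f] outside [c, b], and a sum
   of affine functions only depends on the sum of the arguments. *)
Lemma two_point_majorization n (f D : R -> R) (x y : 'I_n -> R) (c b : R) :
    0 < c -> c <= b ->
    (forall z : R, 0 < z -> is_derive z 1 f (D z)) ->
    (forall s t : R, 0 < s -> s <= t -> 0 <= D t -> D t <= D s) ->
    0 <= D c -> f c <= f b ->
    (forall i, x i = c \/ x i = b) ->
    (forall i, 0 < y i) -> (forall i, y i <= c \/ b <= y i) ->
    \sum_i y i = \sum_i x i ->
  \sum_i f (y i) <= \sum_i f (x i).
Proof.
move=> c0 cb fD Dhomo Dc fcb xcb y0 ycb yx.
have MV (s t : R) : 0 < s -> s <= t ->
    exists z, [/\ s <= z, z <= t & f t - f s = D z * (t - s)].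
  move=> s0 st; apply: mean_value st _ => z /andP[sz _].
  exact/fD/(lt_le_trans s0).
(* [e] is a mean value point, so [D e] is the slope of the chord; if [c = b], the tangent slope
   [D c] takes its place. *)
have [e [ce eb fbc De]] :
    exists e, [/\ c <= e, e <= b, f b - f c = D e * (b - c) & 0 <= D e].
  have [e [ce eb fbc]] := MV c b c0 cb.
  have [cb' | bc] := ltP c b; last first.
    exists c; split=> //.
    by rewrite (le_anti (introT andP (conj cb bc))) !subrr mulr0.
  by exists e; split=> //; rewrite -(@pmulr_lge0 _ (b - c)) ?subr_gt0// -fbc subr_ge0.
pose l (z : R) := f c + D e * (z - c).
have sum_l (z : 'I_n -> R) :
    \sum_i l (z i) = \sum_(i < n) (f c - D e * c) + D e * \sum_i z i.
  by rewrite mulr_sumr -big_split; apply: eq_bigr => i _ /=; rewrite /l; ring.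
have -> : \sum_i f (x i) = \sum_i l (x i).
  by apply: eq_bigr => i _; rewrite /l; case: (xcb i) => ->; lra.
rewrite sum_l -yx -sum_l; apply: ler_sum => i _; rewrite /l.
(* Left of [c] the slopes of [f] are at least [D e], right of [b] at most [D e]; so [f] stays below
   the line [l] on both sides. *)
case: (ycb i) => [yc|yb].
- have [z [yz zc fz]] := MV _ _ (y0 i) yc.
  have : 0 <= (D z - D e) * (c - y i).
    rewrite mulr_ge0 ?subr_ge0//.
    exact: Dhomo (lt_le_trans (y0 i) yz) (le_trans zc ce) De.
  lra.
- have [z [bz zy fz]] := MV _ _ (lt_le_trans c0 cb) yb.
  have : 0 <= (D e - D z) * (y i - b).
    rewrite mulr_ge0 ?subr_ge0//.
    (* A nonnegative slope falls under the concavity hypothesis; a negative one is below [D e]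
       because [0 <= D e]. *)
    have [Dz|/ltW Dz] := leP 0 (D z); last exact: le_trans De.
    exact: Dhomo (lt_le_trans c0 ce) (le_trans eb bz) Dz.
  lra.
Qed.

End concave_then_decreasing.

(** * The two inequalities between the samples at a fixed time *)

Section bose_sums.
Context {R : realType}.
Variables (n : nat) (alpha u c b : R) (x y : 'I_n -> R).
Hypotheses (alpha01 : 0 < alpha <= 1) (u0 : 0 < u) (c0 : 0 < c) (cb : c <= b).
Hypothesis xcb : forall i, x i = c \/ x i = b.
Hypotheses (y0 : forall i, 0 < y i) (ycb : forall i, y i <= c \/ b <= y i).
Hypothesis yx : \sum_i y i = \sum_i x i.

(** [u] stands for t^alpha, so that [pw z] is (z t)^alpha. *)
Let pw (z : R) := u * z `^ alpha.

Let alpha0 : 0 < alpha. Proof. by case/andP: alpha01. Qed.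

Let pw_gt0 z : 0 < z -> 0 < pw z.
Proof. by move=> z0; rewrite mulr_gt0// powR_gt0. Qed.

Let pw_homo s t : 0 < s -> s <= t -> pw s <= pw t.
Proof.
move=> s0 st; rewrite ler_pM2l// ge0_ler_powR ?nnegrE ?(ltW alpha0) ?(ltW s0)//.
exact: le_trans (ltW s0) st.
Qed.

Let dpw (z : R) := u * (alpha * z `^ (alpha - 1)).

Let dpw_gt0 z : 0 < z -> 0 < dpw z.
Proof. by move=> z0; rewrite !mulr_gt0// powR_gt0. Qed.

(** Concavity of z^alpha; this is where alpha <= 1 enters. *)
Let dpw_nhomo s t : 0 < s -> s <= t -> dpw t <= dpw s.
Proof.
move=> s0 st; rewrite ler_pM2l// ler_pM2l//.
rewrite -opprB !powRN lef_pV2 ?posrE ?powR_gt0// ?(lt_le_trans s0)//.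
have a1 : 0 <= 1 - alpha by case/andP: alpha01; rewrite subr_ge0.
by rewrite ge0_ler_powR ?nnegrE ?(ltW s0)// (le_trans (ltW s0)).
Qed.

Let is_derive_pw (G : R -> R) d z : 0 < z -> is_derive (pw z) 1 G d ->
  is_derive z 1 (fun z => G (pw z)) (d * dpw z).
Proof.
move=> z0 Gd; have pwd : is_derive z 1 pw (dpw z).
  have := is_derive1M (is_derive_cst u z 1) (is_derive1_powR alpha z0).
  by congr is_derive; rewrite mul0r add0r.
exact: is_derive1_comp.
Qed.

(** [bose] is decreasing and convex and [pw] is increasing and concave, so [- bose (pw z)] is
    increasing and concave. *)
Lemma sum_bose_le : \sum_i bose (u * x i `^ alpha) <= \sum_i bose (u * y i `^ alpha).
Proof.
rewrite -lerN2 -!sumrN.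
apply: (@two_point_majorization _ _ (fun z => - bose (pw z))
    (fun z => bose (pw z) * bose_slope (pw z) * dpw z) x y c b) => //.
- move=> z z0.
  have := is_derive_pw z0 (is_derive1N (is_derive_bose (pw_gt0 z0))).
  by congr is_derive; rewrite opprK.
- move=> s t s0 st _; have t0 := lt_le_trans s0 st; apply: ler_pM.
  + by rewrite mulr_ge0 ?ltW ?bose_gt0 ?bose_slope_gt0 ?pw_gt0.
  + exact/ltW/dpw_gt0.
  + by rewrite bose_mul_slope_nhomo ?pw_gt0 ?pw_homo.
  + exact: dpw_nhomo.
- apply: ltW; rewrite mulr_gt0 ?dpw_gt0// mulr_gt0 ?bose_gt0//.
    exact: pw_gt0.
  by rewrite bose_slope_gt0 ?pw_gt0.
- by rewrite lerN2 bose_nhomo ?pw_gt0 ?pw_homo.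
Qed.

(** The hypothesis makes [a] the [bose]-weighted mean of [id + bose] over the [pw (x i)]. So [a]
    lies between the values at [pw c] and [pw b], which gives the two endpoint conditions of
    [two_point_majorization]. *)
Lemma sum_bose_weighted_le a :
    \sum_i bose (pw (x i)) * (pw (x i) + bose (pw (x i)) - a) = 0 ->
  \sum_i bose (pw (y i)) * (pw (y i) + bose (pw (y i)) - a) <= 0.
Proof.
have [i0 _|n0 _] := pickP 'I_n; last by rewrite big1// => i; have := n0 i.
move=> sumx0; have b0 := lt_le_trans c0 cb.
have bose_pw_gt0 z : 0 < z -> 0 < bose (pw z) by move=> z0; rewrite bose_gt0 ?pw_gt0.
have x_gec i : c <= x i by case: (xcb i) => ->.
have x_leb i : x i <= b by case: (xcb i) => ->.
have w_homo s t : 0 < s -> s <= t -> pw s + bose (pw s) <= pw t + bose (pw t).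
  by move=> s0 st; rewrite id_add_bose_homo ?pw_gt0 ?pw_homo.
(* Otherwise every term of the vanishing sum would be positive. *)
have ca : pw c + bose (pw c) <= a.
  rewrite leNgt; apply/negP => ac.
  have xi0 i : 0 < bose (pw (x i)) * (pw (x i) + bose (pw (x i)) - a).
    rewrite mulr_gt0 ?subr_gt0 ?bose_pw_gt0 ?(lt_le_trans c0)//.
    exact/(lt_le_trans ac)/w_homo.
  have := psumr_eq0P (fun i _ => ltW (xi0 i)) sumx0 (i := i0) isT.
  by apply/eqP; rewrite gt_eqF.
have ab : a <= pw b + bose (pw b).
  rewrite leNgt; apply/negP => ba.
  have xi0 i : 0 < bose (pw (x i)) * (a - (pw (x i) + bose (pw (x i)))).
    have xi0 := lt_le_trans c0 (x_gec i).
    rewrite mulr_gt0 ?subr_gt0 ?bose_pw_gt0//.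
    exact/(le_lt_trans _ ba)/w_homo.
  have sumx0' : \sum_i bose (pw (x i)) * (a - (pw (x i) + bose (pw (x i)))) = 0.
    apply/eqP; rewrite -oppr_eq0 -sumrN -[X in _ == X]sumx0; apply/eqP.
    by apply: eq_bigr => i _; ring.
  have := psumr_eq0P (fun i _ => ltW (xi0 i)) sumx0' (i := i0) isT.
  by apply/eqP; rewrite gt_eqF.
rewrite -[leRHS]sumx0.
apply: (@two_point_majorization _ _
    (fun z => bose (pw z) * (pw z + bose (pw z) - a))
    (fun z => bose (pw z) * bose_slope (pw z) * (a - bose_level (pw z)) * dpw z)
    x y c b) => //.
- move=> z z0.
  exact: (is_derive_pw (G := fun z => bose z * (z + bose z - a)) z0
    (is_derive_bose_weighted a (pw_gt0 z0))).
- move=> s t s0 st; have t0 := lt_le_trans s0 st.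
  have hv_gt0 z : 0 < z -> 0 < bose (pw z) * bose_slope (pw z).
    by move=> z0; rewrite mulr_gt0 ?bose_gt0 ?bose_slope_gt0 ?pw_gt0.
  (* If the derivative is nonnegative at [t], so is [a - bose_level (pw t)]; then all factors are
     nonnegative at [t] and no smaller at [s]. *)
  rewrite pmulr_lge0 ?dpw_gt0// pmulr_rge0 ?hv_gt0// => ta.
  apply: ler_pM.
  + by rewrite mulr_ge0// ltW// hv_gt0.
  + exact/ltW/dpw_gt0.
  + apply: ler_pM => //; first exact/ltW/hv_gt0.
      by rewrite bose_mul_slope_nhomo ?pw_gt0 ?pw_homo.
    by rewrite lerD2l lerN2 bose_level_homo ?pw_gt0 ?pw_homo.
  + exact: dpw_nhomo.
- rewrite mulr_ge0 ?(ltW (dpw_gt0 _))// mulr_ge0//.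
    by rewrite ltW// mulr_gt0 ?bose_pw_gt0// bose_slope_gt0// pw_gt0.
  by rewrite subr_ge0 (le_trans _ ca)// bose_level_le ?pw_gt0.
(* The function is at most 0 at [c] and at least 0 at [b]. *)
- apply: (@le_trans _ _ 0).
    by rewrite mulr_ge0_le0 ?(ltW (bose_pw_gt0 _ _))// subr_le0.
  by rewrite mulr_ge0 ?(ltW (bose_pw_gt0 _ _))// subr_ge0.
Qed.

End bose_sums.

(** * Order statistics and consequences of majorization *)

Section majorization.
Context {R : realType}.
Variable n : nat.
Implicit Types x y : 'I_n -> R.

Lemma size_order_stat x : size (sort <=%R (codom x)) = n.
Proof. by rewrite size_sort size_codom card_ord. Qed.

Lemma sum_order_stat x : \sum_(0 <= i < n) order_stat x i = \sum_i x i.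
Proof.
transitivity (\sum_(0 <= i < size (sort <=%R (codom x))) order_stat x i).
  by rewrite size_order_stat.
rewrite /order_stat -(big_nth 0 xpredT id).
by rewrite (perm_big (codom x)) ?perm_sort//= codomE big_map big_enum.
Qed.

Lemma order_stat_ex x i : (i < n)%N -> exists j, order_stat x i = x j.
Proof.
move=> ilt; have : order_stat x i \in codom x.
  by rewrite -(mem_sort <=%R) mem_nth// size_order_stat.
by move=> /codomP[j ->]; exists j.
Qed.

Lemma order_stat_rank x j : exists2 i, (i < n)%N & order_stat x i = x j.
Proof.
have : x j \in sort <=%R (codom x) by rewrite mem_sort codom_f.
move=> /(nthP 0)[i]; rewrite size_order_stat => ilt xj; by exists i.
Qed.

Lemma order_stat_homo x i j : (i <= j < n)%N -> order_stat x i <= order_stat x j.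
Proof.
move=> /andP[ij jn]; apply: (sorted_leq_nth le_trans le_refl 0) => //.
- exact: sort_le_sorted.
- by rewrite inE size_order_stat (leq_ltn_trans ij).
- by rewrite inE size_order_stat.
Qed.

Lemma majorized_sum x y : x ⪯m y -> \sum_i x i = \sum_i y i.
Proof. by move=> [_]; rewrite !sum_order_stat. Qed.

(** The partial sums of length 1 compare the two minima. *)
Lemma majorized_le_ex x y i : (1 < n)%N -> x ⪯m y -> exists j, y j <= x i.
Proof.
move=> n1 [/(_ 1) + _]; have -> : (1 <= 1 <= n.-1)%N by case: n n1 => [|[]].
move=> /(_ isT); rewrite !big_nat1 => yx.
have [j yj] := order_stat_ex y (ltnW n1).
have [k kn xk] := order_stat_rank x i.
by exists j; rewrite -yj -xk (le_trans yx)// order_stat_homo.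
Qed.

(** Subtracting the partial sums of length n - 1 from the equal totals compares the two maxima. *)
Lemma majorized_ge_ex x y i : (1 < n)%N -> x ⪯m y -> exists j, x i <= y j.
Proof.
move=> n1 [/(_ n.-1)]; have -> : (1 <= n.-1 <= n.-1)%N.
  by rewrite leqnn andbT; case: n n1 => [|[]].
have nE : n = n.-1.+1 by case: n n1.
have ltn : (n.-1 < n)%N by rewrite [ltnRHS]nE.
have recr z : \sum_(0 <= i < n) order_stat z i =
    \sum_(0 <= i < n.-1) order_stat z i + order_stat z n.-1.
  by rewrite -big_nat_recr// -nE.
move=> /(_ isT) yx; rewrite !recr => xy.
have [j yj] := order_stat_ex y ltn.
have [k kn xk] := order_stat_rank x i.
exists j; rewrite -yj -xk (@le_trans _ _ (order_stat x n.-1))//.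
  by rewrite order_stat_homo// ltn andbT -ltnS -nE.
lra.
Qed.

End majorization.

(** The second vector has an entry at most [Num.min a b] and one at least [Num.max a b], and it
    takes only the values [c] and [d]. *)
Lemma two_block_majorized (R : realType) (n p : nat) (a b c d : R) :
  (0 < p < n)%N -> two_block n p a b ⪯m two_block n p c d ->
  forall i, two_block n p c d i <= Num.min a b \/ Num.max a b <= two_block n p c d i.
Proof.
move=> /andP[p0 pn] ab_cd i; have n1 := leq_ltn_trans p0 pn.
have ab_ex e : e = a \/ e = b -> exists j, two_block n p a b j = e.
  case=> ->; last by exists (Ordinal pn); rewrite /two_block ltnn.
  by exists (Ordinal (ltn_trans p0 pn)); rewrite /two_block p0.
have min_ab : Num.min a b = a \/ Num.min a b = b.
  by rewrite minElt; case: ifP; [left|right].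
have max_ab : Num.max a b = a \/ Num.max a b = b.
  by rewrite maxElt; case: ifP; [right|left].
have [j1 yj1] : exists j, two_block n p c d j <= Num.min a b.
  by have [k <-] := ab_ex _ min_ab; exact: majorized_le_ex.
have [j2 yj2] : exists j, Num.max a b <= two_block n p c d j.
  by have [k <-] := ab_ex _ max_ab; exact: majorized_ge_ex.
have [yi|yi] := leP (two_block n p c d i) (Num.min a b); [by left|right].
move: yi yj1 yj2; rewrite /two_block.
by case: (i < p)%N; case: (j1 < p)%N; case: (j2 < p)%N; lra.
Qed.

(** * Distribution function, density and density ratio of the maximum *)

Section weibull_maximum.
Context {R : realType}.
Variable alpha : R.
Hypothesis alpha0 : 0 < alpha.

Let is_derive_weibull_arg (lambda t : R) : 0 < lambda -> 0 < t ->
  is_derive t 1 (fun t => (lambda * t) `^ alpha)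
    ((lambda * t) `^ alpha * (alpha / t)).
Proof.
move=> l0 t0; have lt0 : 0 < lambda * t by rewrite mulr_gt0.
have ld := is_derive1M (is_derive_cst lambda t 1) (is_derive_id t 1).
have := @is_derive1_comp _ (@powR R ^~ alpha) _ _ _ _ (is_derive1_powR alpha lt0) ld.
rewrite -(mulr_powRB1 (ltW lt0) alpha0); congr is_derive.
by rewrite /cst/=; field; rewrite gt_eqF.
Qed.

Definition weibull_cdf (lambda t : R) : R := 1 - expR (- (lambda * t) `^ alpha).

Lemma weibull_cdf_gt0 (lambda t : R) : 0 < lambda -> 0 < t -> 0 < weibull_cdf lambda t.
Proof.
by move=> l0 t0; rewrite subr_gt0 expR_lt1 oppr_lt0 powR_gt0// mulr_gt0.
Qed.

(** The derivative is kept as the function times its reversed hazard rate, the form that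
    [is_derive1_prod] takes. *)
Lemma is_derive_weibull_cdf (lambda t : R) : 0 < lambda -> 0 < t ->
  is_derive t 1 (weibull_cdf lambda)
    (weibull_cdf lambda t * (bose ((lambda * t) `^ alpha) * (alpha / t))).
Proof.
move=> l0 t0.
have := is_derive1D (is_derive_cst (1 : R) t 1) (is_derive1N
  (is_derive1_comp (is_derive_expR _)
    (is_derive1N (is_derive_weibull_arg l0 t0)))).
have x0 : 0 < (lambda * t) `^ alpha by rewrite powR_gt0// mulr_gt0.
congr is_derive; rewrite /weibull_cdf /bose expRN.
by field; rewrite !gt_eqF ?expR_gt0 ?expR_sub1_gt0.
Qed.

Lemma cvg_weibull_cdf (lambda : R) : 0 < lambda ->
  weibull_cdf lambda t @[t --> +oo] --> (1 : R).
Proof.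
move=> l0; rewrite -[X in _ --> X]subr0; apply: cvgB; first exact: cvg_cst.
have arg_oo : (lambda * t) `^ alpha @[t --> +oo] --> +oo.
  apply/cvgryPge => A; near=> t.
  (* It suffices that t >= |A|^(1/alpha) / lambda. *)
  have At : `|A| `^ alpha^-1 <= lambda * t.
    by rewrite mulrC -ler_pdivrMr//; near: t; exact: nbhs_pinfty_ge.
  apply: (le_trans (ler_norm A)); rewrite -[leLHS]powRr1//.
  rewrite -(mulVf (lt0r_neq0 alpha0)) powRrM.
  by rewrite ge0_ler_powR ?nnegrE ?powR_ge0 ?(ltW alpha0)// (le_trans _ At) ?powR_ge0.
exact: cvg_comp arg_oo (@cvgr_expR R).
Unshelve. all: by end_near. Qed.

Lemma weibull_pdfE (lambda t : R) : 0 < lambda -> 0 < t ->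
  weibull_pdf alpha lambda t =
  weibull_cdf lambda t * (bose ((lambda * t) `^ alpha) * (alpha / t)).
Proof.
move=> l0 t0; rewrite /weibull_pdf t0 /weibull_cdf /bose expRN.
have lt0 : 0 < lambda * t by rewrite mulr_gt0.
have x0 : 0 < (lambda * t) `^ alpha by rewrite powR_gt0.
have E0 := expR_sub1_gt0 x0; have e0 := expR_gt0 ((lambda * t) `^ alpha).
move: x0 E0 e0; rewrite -(mulr_powRB1 (ltW lt0) alpha0) => x0 E0 e0.
by field; rewrite !gt_eqF.
Qed.

Variable n : nat.
Implicit Types (lambda x y : 'I_n.+1 -> R) (t : R).

Definition weibull_max_cdf lambda (t : R) : R := \prod_i weibull_cdf (lambda i) t.

Definition bose_sum lambda (t : R) : R := \sum_i bose ((lambda i * t) `^ alpha).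

Definition bose_weighted_sum lambda (t : R) : R :=
  \sum_i bose ((lambda i * t) `^ alpha) *
    ((lambda i * t) `^ alpha + bose ((lambda i * t) `^ alpha)).

Definition weibull_max_pdf lambda (t : R) : R :=
  weibull_max_cdf lambda t * (bose_sum lambda t * (alpha / t)).

Lemma weibull_max_cdf_gt0 lambda t : (forall i, 0 < lambda i) -> 0 < t ->
  0 < weibull_max_cdf lambda t.
Proof. by move=> l0 t0; apply: prodr_gt0 => i _; exact: weibull_cdf_gt0. Qed.

Lemma bose_sum_gt0 lambda t : (forall i, 0 < lambda i) -> 0 < t ->
  0 < bose_sum lambda t.
Proof.
move=> l0 t0; have b0 i : 0 < bose ((lambda i * t) `^ alpha).
  by rewrite bose_gt0// powR_gt0// mulr_gt0.
rewrite /bose_sum big_ord_recl ltr_pwDl// sumr_ge0// => i _.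
exact: ltW.
Qed.

Lemma weibull_max_pdf_gt0 lambda t : (forall i, 0 < lambda i) -> 0 < t ->
  0 < weibull_max_pdf lambda t.
Proof.
move=> l0 t0; rewrite mulr_gt0 ?weibull_max_cdf_gt0//.
by rewrite mulr_gt0 ?bose_sum_gt0// divr_gt0.
Qed.

Lemma is_derive_weibull_max_cdf lambda t : (forall i, 0 < lambda i) -> 0 < t ->
  is_derive t 1 (weibull_max_cdf lambda) (weibull_max_pdf lambda t).
Proof.
move=> l0 t0; have := is_derive1_prod (fun i => is_derive_weibull_cdf (l0 i) t0).
by rewrite -mulr_suml.
Qed.

(** For x = (lambda t)^alpha and h = [bose], t x' = alpha x and x h'(x) = h(x) (1 - x - h(x)). *)
Lemma is_derive_bose_sum lambda t : (forall i, 0 < lambda i) -> 0 < t ->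
  is_derive t 1 (bose_sum lambda)
    ((bose_sum lambda t - bose_weighted_sum lambda t) * (alpha / t)).
Proof.
move=> l0 t0; pose x i := (lambda i * t) `^ alpha.
have x0 i : 0 < x i by rewrite powR_gt0// mulr_gt0.
have := is_derive1_sum (fun i =>
  is_derive1_comp (g := fun t => (lambda i * t) `^ alpha)
    (is_derive_bose (x0 i)) (is_derive_weibull_arg (l0 i) t0)).
congr is_derive; rewrite -sumrB mulr_suml; apply: eq_bigr => i _.
rewrite -/(x i) /bose_slope /bose; have E0 := expR_sub1_gt0 (x0 i).
by field; rewrite !gt_eqF.
Qed.

Lemma weibull_max_pdf_ratio x y (c b : R) : alpha <= 1 -> 0 < c -> c <= b ->
    (forall i, x i = c \/ x i = b) -> (forall i, 0 < y i) ->
    (forall i, y i <= c \/ b <= y i) -> \sum_i y i = \sum_i x i ->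
  forall s t, 0 < s -> s <= t ->
    weibull_max_pdf y s / weibull_max_pdf x s <=
    weibull_max_pdf y t / weibull_max_pdf x t.
Proof.
move=> alpha1 c0 cb xcb y0 ycb yx s t s0 st.
have alpha01 : 0 < alpha <= 1 by rewrite alpha0.
have x0 i : 0 < x i by case: (xcb i) => -> //; exact: lt_le_trans cb.
have argE z r : 0 < z -> 0 < r -> (z * r) `^ alpha = r `^ alpha * z `^ alpha.
  by move=> z0 r0; rewrite mulrC powRM ?ltW.
have sum_le r : 0 < r -> bose_sum x r <= bose_sum y r.
  move=> r0; have sumE z : (forall i, 0 < z i) ->
      bose_sum z r = \sum_i bose (r `^ alpha * z i `^ alpha).
    by move=> z0; apply: eq_bigr => i _; rewrite argE.
  rewrite (sumE x x0) (sumE y y0).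
  exact: (sum_bose_le alpha01 (powR_gt0 _ r0) c0 cb).
have weighted_le r : 0 < r ->
    bose_weighted_sum y r <= bose_sum y r * (bose_weighted_sum x r / bose_sum x r).
  move=> r0; have Sx0 : 0 < bose_sum x r by exact: bose_sum_gt0.
  have weightedE z a : \sum_i bose ((z i * r) `^ alpha) *
      ((z i * r) `^ alpha + bose ((z i * r) `^ alpha) - a) =
      bose_weighted_sum z r - bose_sum z r * a.
    by rewrite /bose_sum mulr_suml -sumrB; apply: eq_bigr => i _; rewrite mulrBr.
  (* The mean is [bose_weighted_sum x r / bose_sum x r], for which the sum over [x] vanishes. *)
  rewrite -subr_le0 -weightedE; under eq_bigr do rewrite argE//.
  apply: (sum_bose_weighted_le (x := x) alpha01 (powR_gt0 _ r0) c0 cb) => //.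
  under eq_bigr do rewrite -argE//.
  by rewrite weightedE mulrCA divff ?gt_eqF// mulr1 subrr.
(* The quotient rule reduces this to [sum_le]. *)
have cdf_ratio : weibull_max_cdf y s / weibull_max_cdf x s <=
    weibull_max_cdf y t / weibull_max_cdf x t.
  apply: (ratio_homo (df := weibull_max_pdf x) (dg := weibull_max_pdf y)) s0 st => r r0.
  - exact: is_derive_weibull_max_cdf.
  - exact: is_derive_weibull_max_cdf.
  - exact: weibull_max_cdf_gt0.
  have Fx0 : 0 < weibull_max_cdf x r by exact: weibull_max_cdf_gt0.
  have Fy0 : 0 < weibull_max_cdf y r by exact: weibull_max_cdf_gt0.
  have ar0 : 0 < alpha / r by rewrite divr_gt0.
  rewrite /weibull_max_pdf; move: (sum_le r r0) Fx0 Fy0 ar0.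
  move: (weibull_max_cdf x r) (weibull_max_cdf y r) => Fx Fy.
  move: (bose_sum x r) (bose_sum y r) (alpha / r) => Sx Sy k SxSy Fx0 Fy0 k0.
  by rewrite mulrA [leRHS]mulrAC ler_pM2l ?mulr_gt0// ler_pM2r.
(* The products of the two sums cancel in the quotient rule, which leaves [weighted_le]. *)
have sum_ratio : bose_sum y s / bose_sum x s <= bose_sum y t / bose_sum x t.
  apply: (ratio_homo
    (df := fun r => (bose_sum x r - bose_weighted_sum x r) * (alpha / r))
    (dg := fun r => (bose_sum y r - bose_weighted_sum y r) * (alpha / r)))
    s0 st => r r0.
  - exact: is_derive_bose_sum.
  - exact: is_derive_bose_sum.
  - exact: bose_sum_gt0.
  have ByBx := weighted_le r r0; have Sx0 : 0 < bose_sum x r by exact: bose_sum_gt0.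
  have ar0 : 0 < alpha / r by rewrite divr_gt0.
  move: ByBx Sx0 ar0; move: (bose_weighted_sum x r) (bose_weighted_sum y r).
  move: (bose_sum x r) (bose_sum y r) (alpha / r) => Sx Sy k Bx By ByBx Sx0 k0.
  rewrite [leRHS]mulrAC mulrA ler_pM2r// mulrBr mulrBl lerD2l lerN2.
  by rewrite -ler_pdivlMr// -mulrA.
have pdfE z r : 0 < r -> weibull_max_pdf z r / weibull_max_pdf x r =
    (weibull_max_cdf z r / weibull_max_cdf x r) * (bose_sum z r / bose_sum x r).
  move=> r0; rewrite /weibull_max_pdf -mulf_div -[X in _ * X]mulf_div divff ?mulr1//.
  by rewrite gt_eqF// divr_gt0.
have t0 := lt_le_trans s0 st; rewrite (pdfE y s s0) (pdfE y t t0).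
apply: ler_pM cdf_ratio sum_ratio.
  by rewrite divr_ge0 ?ltW ?weibull_max_cdf_gt0.
by rewrite divr_ge0 ?ltW ?bose_sum_gt0.
Qed.

End weibull_maximum.

(** * Tail integrals, measures given by a density, and equality of measures from their tails *)

Section tail_integral.
Context {R : realType}.
Local Notation mu := (@lebesgue_measure R).

(** The fundamental theorem of calculus, kept away from 0, where the Weibull density is unbounded if
    alpha < 1. *)
Lemma integral_tail (g G : R -> R) (l a : R) : 0 < a ->
    (forall t : R, 0 < t -> is_derive t 1 G (g t)) ->
    (forall t : R, 0 < t -> {for t, continuous g}) ->
    (forall t : R, 0 < t -> 0 <= g t) -> G t @[t --> +oo] --> l ->
  (\int[mu]_(t in `]a, +oo[) (g t)%:E = (l - G a)%:E)%E.
Proof.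
move=> a0 Gg cg g0 Gl.
have pos t : a <= t -> 0 < t by exact: lt_le_trans.
rewrite integral_itv_obnd_cbnd; last first.
  apply/measurable_EFinP; apply: open_continuous_measurable_fun.
    exact: interval_open.
  by move=> t; rewrite inE/= in_itv/= andbT => /ltW /pos; exact: cg.
rewrite (@ge0_continuous_FTC2y _ g G a l) ?EFinB//.
- by move=> t /pos; exact: g0.
- apply: continuous_in_subspaceT => t.
  by rewrite inE/= in_itv/= andbT => /pos; exact: cg.
- by move=> t /ltW /pos /Gg[].
- exact/cvg_at_right_filter/is_derive1_continuous/Gg.
- move=> t; rewrite in_itv/= andbT => /ltW /pos /Gg[_ <-].
  exact: derive1E.
Qed.

End tail_integral.

Section density_measure.
Context {R : realType}.
Local Notation mu := (@lebesgue_measure R).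
Variable g : R -> R.
Hypotheses (mg : measurable_fun setT g) (g0 : forall t, 0 <= g t).

(* The proof arguments are there for the measure instance to be inferable. *)
Definition density_measure of measurable_fun setT g & (forall t, 0 <= g t) :=
  fun A : set R => (\int[mu]_(t in A) (g t)%:E)%E.

Local Notation nu := (density_measure mg g0).

Let nu0 : nu set0 = 0%E. Proof. exact: integral_set0. Qed.

Let nu_ge0 A : (0 <= nu A)%E.
Proof. by apply: integral_ge0 => t _; rewrite lee_fin. Qed.

Let nu_sigma_additive : semi_sigma_additive nu.
Proof.
apply: (@semi_sigma_additive_nng_induced _ _ _ mu (EFin \o g)); first exact/measurable_EFinP.
by move=> t; rewrite lee_fin.
Qed.

HB.instance Definition _ :=
  isMeasure.Build _ _ _ nu nu0 nu_ge0 nu_sigma_additive.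

End density_measure.

Section positive_density.
Context {R : realType}.

Let positive_bigcup :
  `]0, +oo[%classic = \bigcup_k `]k.+1%:R^-1, +oo[%classic :> set R.
Proof.
apply/seteqP; split=> [t|t [k _]]/=; rewrite !in_itv/= !andbT.
  move=> /ltr_add_invr[k]; rewrite add0r => kt.
  by exists k => //=; rewrite in_itv/= kt.
by apply: lt_trans; rewrite invr_gt0.
Qed.

(** The rays []a, +oo[] generate the Borel sets and are stable under intersection. The ray from 0 is
    an increasing union of rays from positive points, and a ray from [a <= 0] differs from it by a
    null set. *)
Lemma eq_measure_tails (m1 m2 : {measure set R -> \bar R}) :
    m1 `]-oo, 0]%classic = 0%E -> m2 `]-oo, 0]%classic = 0%E ->
    (forall a, 0 < a -> m1 `]a, +oo[%classic = m2 `]a, +oo[%classic) ->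
    (m1 setT < +oo)%E ->
  forall A, measurable A -> m1 A = m2 A.
Proof.
move=> m10 m20 m12 m1T.
have m12_0 : m1 `]0, +oo[%classic = m2 `]0, +oo[%classic.
  have cvg_m (m : {measure set R -> \bar R}) :
      m `]k.+1%:R^-1, +oo[%classic @[k --> \oo] --> m `]0%R, +oo[%classic.
    rewrite positive_bigcup; apply: nondecreasing_cvg_mu => //.
      exact: bigcup_measurable.
    move=> j k jk; apply/subsetPset => t /=; rewrite !in_itv/= !andbT.
    by apply: le_lt_trans; rewrite lef_pV2 ?posrE// ler_nat.
  have m12k : (fun k => m1 `]k.+1%:R^-1, +oo[%classic) =
              (fun k => m2 `]k.+1%:R^-1, +oo[%classic).
    by apply/funext => k; rewrite m12 ?invr_gt0.
  by apply: (cvg_unique _ (cvg_m m1)) => //; rewrite m12k; exact: cvg_m.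
have ray_nonpos (m : {measure set R -> \bar R}) a : a <= 0 ->
    m `]-oo, 0]%classic = 0%E -> m `]a, +oo[%classic = m `]0%R, +oo[%classic.
  move=> a0 m0; rewrite (@itv_bndbnd_setU _ _ (BRight a) (BRight (0 : R)))//.
  rewrite measureU//; last first.
    rewrite -subset0 => t [] /=.
    by rewrite !in_itv/= andbT => /andP[_ /le_lt_trans lt0] /lt0; rewrite ltxx.
  rewrite -[RHS]add0e; congr (_ + _)%E.
  apply: (subset_measure0 _ _ _ m0) => // t /=.
  by rewrite !in_itv/= => /andP[].
move=> A mA.
apply: (@measure_unique _ R _ (@RGenOInfty.G R) (fun k => `]- k%:R, +oo[%classic)
  _ _ _ _ m1 m2) => //.
- exact: RGenOInfty.measurableE.
- move=> _ _ [a ->] [b ->]; exists (Num.max a b).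
  by apply/seteqP; split=> t /=; rewrite !in_itv/= !andbT gt_max => /andP.
- by move=> k; exists (- k%:R).
- rewrite -subTset => t _; exists (Num.bound `|t|) => //=.
  rewrite in_itv/= andbT ltrNl.
  by rewrite (le_lt_trans (ler_norm _))// normrN archi_boundP.
- move=> _ [a ->]; have [a0|a0] := leP a 0; last exact: m12.
  by rewrite !ray_nonpos.
- by move=> k; apply: le_lt_trans m1T; apply: le_measure; rewrite ?inE.
Qed.

End positive_density.

(** * From independent Weibull variables to a density of their maximum *)

Section weibull_distribution.
Context {R : realType} d (T : measurableType d) (P : probability T R).
Variable alpha : R.
Hypothesis alpha0 : 0 < alpha.
Local Notation mu := (@lebesgue_measure R).

Lemma continuous_weibull_max_pdf n (lambda : 'I_n.+1 -> R) (t : R) :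
  (forall i, 0 < lambda i) -> 0 < t ->
  {for t, continuous (weibull_max_pdf alpha lambda)}.
Proof.
move=> l0 t0; apply: continuousM.
  exact/is_derive1_continuous/is_derive_weibull_max_cdf.
apply: continuousM; first exact/is_derive1_continuous/is_derive_bose_sum.
by apply: continuousM; [exact: cvg_cst | apply: inv_continuous; rewrite gt_eqF].
Qed.

Lemma cvg_weibull_max_cdf n (lambda : 'I_n.+1 -> R) : (forall i, 0 < lambda i) ->
  weibull_max_cdf alpha lambda t @[t --> +oo] --> (1 : R).
Proof.
move=> l0; rewrite (_ : 1 = \prod_(i < n.+1) (1 : R)); last by rewrite big1.
apply: cvg_big => [|i _]; first exact: mul_continuous.
exact: cvg_weibull_cdf.
Qed.

Lemma integral_weibull_max_pdf n (lambda : 'I_n.+1 -> R) (a : R) :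
  (forall i, 0 < lambda i) -> 0 < a ->
  (\int[mu]_(t in `]a, +oo[) (weibull_max_pdf alpha lambda t)%:E =
   (1 - weibull_max_cdf alpha lambda a)%:E)%E.
Proof.
move=> l0 a0; apply: integral_tail => //.
- by move=> t t0; exact: is_derive_weibull_max_cdf.
- by move=> t t0; exact: continuous_weibull_max_pdf.
- by move=> t t0; exact/ltW/weibull_max_pdf_gt0.
- exact: cvg_weibull_max_cdf.
Qed.

Lemma weibull_distributed_cdf (X : {RV P >-> R}) (lambda a : R) :
  0 < lambda -> weibull_distributed X alpha lambda -> 0 < a ->
  distribution P X `]-oo, a]%classic = (weibull_cdf alpha lambda a)%:E.
Proof.
move=> l0 [_ _ Xpdf] a0.
have -> : distribution P X `]-oo, a]%classic =
    (1 - distribution P X `]a, +oo[%classic)%E.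
  by rewrite -setCitvr probability_setC.
(* A single variable is treated as a maximum over ['I_1]. *)
rewrite Xpdf//; transitivity
    (1 - (1 - weibull_max_cdf alpha (fun _ : 'I_1 => lambda) a)%:E)%E; last first.
  by rewrite /weibull_max_cdf big_ord1 -EFinB opprB addrC subrK.
congr (1 - _)%E; rewrite -integral_weibull_max_pdf//; apply: eq_integral => t.
rewrite inE/= in_itv/= andbT => /(lt_trans a0) t0.
by rewrite /weibull_max_pdf /weibull_max_cdf /bose_sum !big_ord1 weibull_pdfE.
Qed.

Lemma weibull_distributed_nonpos (X : {RV P >-> R}) (lambda : R) :
  weibull_distributed X alpha lambda -> distribution P X `]-oo, 0%R]%classic = 0%E.
Proof.
move=> [_ _ Xpdf]; rewrite Xpdf//; apply: integral0_eq => t /=.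
by rewrite in_itv/= => t0; rewrite /weibull_pdf ltNge t0.
Qed.

Lemma distribution_max_RV n (X : 'I_n.+1 -> {RV P >-> R}) (a : R) :
  independent_RVs X ->
  distribution P (max_RV X : {RV P >-> R}) `]-oo, a]%classic =
  (\prod_i distribution P (X i) `]-oo, a]%classic)%E.
Proof.
move=> /(_ [set: 'I_n.+1]%SET (fun=> `]-oo, a]%classic)) Xindep.
rewrite /distribution /pushforward.
transitivity (\prod_(i in [set: 'I_n.+1]%SET) P (X i @^-1` `]-oo, a]))%E; last first.
  by apply: eq_bigl => i; rewrite inE.
rewrite -Xindep//; congr (P _); apply/seteqP; split=> w /=.
  rewrite in_itv/= => /bigmax_leP[_ Xa] i _ /=; rewrite in_itv/=; exact: Xa.
move=> Xa; rewrite in_itv/=; apply/bigmax_leP; split=> [|i _].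
  by have := Xa ord0; rewrite /= in_itv/=; apply; rewrite inE.
by have := Xa i; rewrite /= in_itv/=; apply; rewrite inE.
Qed.

(** The law of the maximum and the measure of the restricted density vanish on []-oo, 0]] and have
    equal tails from every [a > 0]. *)
Lemma max_weibull_has_density n (X : 'I_n.+1 -> {RV P >-> R})
    (lambda : 'I_n.+1 -> R) : (forall i, 0 < lambda i) ->
    independent_RVs X -> (forall i, weibull_distributed (X i) alpha (lambda i)) ->
  has_density (max_RV X : {RV P >-> R})
    (weibull_max_pdf alpha lambda \_ `]0, +oo[).
Proof.
move=> l0 Xindep Xw; set f := _ \_ _.
have mf : measurable_fun setT f.
  apply/(measurable_restrictT (weibull_max_pdf alpha lambda) (measurable_itv `]0, +oo[)).
  apply: open_continuous_measurable_fun => [|t].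
    exact: interval_open.
  by rewrite inE/= in_itv/= andbT; exact: continuous_weibull_max_pdf.
have f0 t : 0 <= f t.
  rewrite /f patchE; case: ifPn => //.
  by rewrite inE/= in_itv/= andbT => /(weibull_max_pdf_gt0 alpha0 l0) /ltW.
split=> //.
have maxE a : 0 < a -> distribution P (max_RV X : {RV P >-> R}) `]-oo, a]%classic =
    (weibull_max_cdf alpha lambda a)%:E.
  move=> a0; rewrite distribution_max_RV// /weibull_max_cdf -prodEFin.
  by apply: eq_bigr => i _; exact: weibull_distributed_cdf.
move=> A mA.
apply: (@eq_measure_tails _ (distribution P (max_RV X : {RV P >-> R}))
  (density_measure mf f0)) mA.
(* One zero factor, the one of [ord0], kills the product. *)
- apply: etrans (distribution_max_RV 0 Xindep) _; rewrite big_ord_recl.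
  by rewrite (weibull_distributed_nonpos (Xw ord0)) mul0e.
- apply: integral0_eq => t /=; rewrite in_itv/= => t0.
  by rewrite /f patchE ifF// memNset//= in_itv/= andbT; apply/negP; rewrite -leNgt.
- move=> a a0.
  have tailE : distribution P (max_RV X : {RV P >-> R}) `]a, +oo[%classic =
      (1 - distribution P (max_RV X : {RV P >-> R}) `]-oo, a]%classic)%E.
    by rewrite -setCitvl probability_setC.
  apply: (etrans tailE); rewrite maxE// -EFinB -integral_weibull_max_pdf//.
  apply: eq_integral => t.
  rewrite inE/= in_itv/= andbT => /(lt_trans a0) t0.
  by rewrite /f patchE ifT// inE/= in_itv/= t0.
- apply: le_lt_trans (ltry 1).
  exact: (probability_le1 (distribution P (max_RV X : {RV P >-> R}))).
Qed.

End weibull_distribution.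

(** * Likelihood ratio order of the two maxima *)

Theorem theorem4p7 (R : realType) (n p q : nat)
    (hp : (1 <= p)%N) (hq : (1 <= q)%N) (hn : (p + q)%N = n.+1)
    (alpha lambda1 lambda2 theta1 theta2 : R)
    (halpha : 0 < alpha <= 1)
    (hlambda1 : 0 < lambda1) (hlambda2 : 0 < lambda2)
    (htheta1 : 0 < theta1) (htheta2 : 0 < theta2)
    (d : measure_display) (T : measurableType d) (P : probability T R)
    (X : 'I_n.+1 -> {RV P >-> R})
    (hXindep : independent_RVs X)
    (hX : forall i : 'I_n.+1,
       weibull_distributed (X i) alpha (two_block n.+1 p lambda1 lambda2 i))
    (d' : measure_display) (T' : measurableType d') (Q : probability T' R)
    (Y : 'I_n.+1 -> {RV Q >-> R})
    (hYindep : independent_RVs Y)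
    (hY : forall i : 'I_n.+1,
       weibull_distributed (Y i) alpha (two_block n.+1 p theta1 theta2 i)) :
  two_block n.+1 p lambda1 lambda2 ⪯m two_block n.+1 p theta1 theta2 ->
  lr_le (max_RV X : {RV P >-> R}) (max_RV Y : {RV Q >-> R}).
Proof.
move=> maj; have /andP[alpha0 alpha1] := halpha.
set x := two_block _ _ _ _ in hX maj; set y := two_block _ _ _ _ in hY maj.
have x0 i : 0 < x i by rewrite /x /two_block; case: ifP.
have y0 i : 0 < y i by rewrite /y /two_block; case: ifP.
have pn : (0 < p < n.+1)%N by rewrite hp -hn -addn1 leq_add2l.
pose f z := weibull_max_pdf alpha z \_ `]0, +oo[.
exists (f n x), (f n y); split; [exact: max_weibull_has_density..|].
have f_nonpos z t : t <= 0 -> f n z t = 0.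
  by move=> t0; rewrite /f patchE memNset//= in_itv/= andbT; apply/negP; rewrite -leNgt.
have f_pos z t : 0 < t -> f n z t = weibull_max_pdf alpha z t.
  by move=> t0; rewrite /f patchE mem_set//= in_itv/= t0.
(* Both densities vanish for t <= 0, so the ratio is compared at positive times only, where both are
   positive and it is a real number. *)
have pos t : f n x t != 0 \/ f n y t != 0 -> 0 < t.
  by have [t0|//] := leP t 0; rewrite !f_nonpos// eqxx => -[].
move=> s t st /pos s0 /pos t0.
have fx0 r : 0 < r -> weibull_max_pdf alpha x r != 0.
  by move=> r0; rewrite gt_eqF// weibull_max_pdf_gt0.
rewrite !f_pos// !inver !(negbTE (fx0 _ _))// -!EFinM lee_fin.
apply: (@weibull_max_pdf_ratio _ _ alpha0 _ x y (Num.min lambda1 lambda2)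
  (Num.max lambda1 lambda2)) => //.
- by rewrite lt_min hlambda1.
- by rewrite ge_min le_max lexx.
- move=> i; rewrite /x /two_block minElt maxElt.
  by case: ifP; case: ifP; [left|right|right|left].
- exact: two_block_majorized maj.
- by rewrite (majorized_sum maj).
Qed.
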